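(* For any two mm-spaces $X$ and $Y$, \[ d_{\mathrm{conc}}(X,Y)=\min_{\pi\in\Pi(m_X,m_Y)} d_{\mathrm{conc}}^{\pi}(X,Y); \] in particular the minimum is attained by some transport plan.
   Context: An mm-space is a complete separable metric space $(X,d_X)$ with a Borel probability measure $m_X$. $\Pi(m_X,m_Y)$: Borel probability measures on $X\times Y$ with marginals $m_X,m_Y$. $\mathcal{L}ip_1(X)$ is the set of 1-Lipschitz functions $X\to\mathbb R$. For a measure space $(Z,\mu)$ and measurable $f,g:Z\to\mathbb R$, the Ky Fan metric is $d_{\mathrm{KF}}^\mu(f,g):=\inf\{\varepsilon\ge0:\mu(\{|f-g|>\varepsilon\})\le\varepsilon\}$; $d_{\mathrm H}^{d_{\mathrm{KF}}^\mu}$ denotes the Hausdorff distance between sets of functions with respect to $d_{\mathrm{KF}}^\mu$. For $F:A\to B$, $G:B\to C$ write $F^*G:=G\circ F$. For $\pi\in\Pi(m_X,m_Y)$, $d_{\mathrm{conc}}^{\pi}(X,Y):=d_{\mathrm H}^{d_{\mathrm{KF}}^\pi}(\mathrm{pr}_1^*\mathcal{L}ip_1(X),\mathrm{pr}_2^*\mathcal{L}ip_1(Y))$. $I=[0,1)$ with Lebesgue measure $\mathcal L^1$; a parameter of $X$ is a Borel $\varphi:I\to X$ with $\varphi_*\mathcal L^1=m_X$. The observable distance is $d_{\mathrm{conc}}(X,Y):=\inf_{\varphi,\psi}d_{\mathrm H}^{d_{\mathrm{KF}}^{\mathcal L^1}}(\varphi^*\mathcal{L}ip_1(X),\psi^*\mathcal{L}ip_1(Y))$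 over parameters $\varphi$ of $X$, $\psi$ of $Y$, where $\varphi^*\mathcal{L}ip_1(X)=\{f\circ\varphi: f\in\mathcal{L}ip_1(X)\}$. *)

(* Defs.v *)
From HB Require Import structures.
From mathcomp Require Import all_boot all_order all_algebra.
From mathcomp Require Import all_classical all_reals all_analysis.
Set Implicit Arguments. Unset Strict Implicit. Unset Printing Implicit Defensive.
Import Order.TTheory GRing.Theory Num.Theory.
Import numFieldNormedType.Exports.
Local Open Scope classical_set_scope.
Local Open Scope ring_scope.
Local Open Scope ereal_scope.

(* metric spaces with a distinguished point (needed by the library to build the
   generated sigma-algebra; harmless since mm-spaces carry a probability measure,
   hence are nonempty) *)
#[short(type="pmetricType")]
HB.structure Definition PointedMetric (K : numDomainType) :=
  { M of Pointed M & Metric K M }.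

Notation borelT X := (g_sigma_algebraType (@open X)).

Definition complete_space {R : realType} (X : pmetricType R) : Prop :=
  forall u : nat -> X,
    (forall e : R, (0 < e)%R -> exists N : nat, forall m n : nat,
        (N <= m)%N -> (N <= n)%N -> (mdist (u m) (u n) < e)%R) ->
    exists l : X, u @ \oo --> l.

Definition separable_space (X : topologicalType) : Prop :=
  exists D : set X, countable D /\ dense D.

Definition Lip1 {R : realType} (X : pmetricType R) : set (X -> R) :=
  [set f | forall x y, (`|f x - f y| <= mdist x y)%R].

Definition kyfan {R : realType} {d} {Z : measurableType d}
    (mu : set Z -> \bar R) (D : set Z) (f g : Z -> R) : \bar R :=
  ereal_inf [set e%:E | e in [set e : R |
     (0 <= e)%R /\ mu (D `&` [set z | (e < `|f z - g z|)%R]) <= e%:E]].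

Definition hausdorff {R : realType} {T : Type} (dist : T -> T -> \bar R)
    (A B : set T) : \bar R :=
  maxe (ereal_sup [set ereal_inf [set dist f g | g in B] | f in A])
       (ereal_sup [set ereal_inf [set dist f g | f in A] | g in B]).

Definition coupling {R : realType} {X Y : pmetricType R}
    (mX : probability (borelT X) R) (mY : probability (borelT Y) R)
    (pi : probability (borelT X * borelT Y)%type R) : Prop :=
  (forall A : set (borelT X), measurable A -> pi (A `*` setT) = mX A) /\
  (forall B : set (borelT Y), measurable B -> pi (setT `*` B) = mY B).

Definition dconc_pi {R : realType} {X Y : pmetricType R}
    (pi : probability (borelT X * borelT Y)%type R) : \bar R :=
  hausdorff (kyfan pi setT)
    [set (fun z : borelT X * borelT Y => f z.1) | f in @Lip1 R X]
    [set (fun z : borelT X * borelT Y => g z.2) | g in @Lip1 R Y].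

(* I = [0,1) with Lebesgue measure; a parameter of X is a Borel map
   phi : I -> X (represented on R, only its values on [0,1) matter)
   with phi_* L^1 = m_X. *)
Definition parameter {R : realType} {X : pmetricType R}
    (mX : probability (borelT X) R) (phi : R -> borelT X) : Prop :=
  measurable_fun (`[0%R, 1%R[ : set R) phi /\
  forall A : set (borelT X), measurable A ->
    lebesgue_measure (`[0%R, 1%R[ `&` phi @^-1` A) = mX A.

Definition dconc {R : realType} {X Y : pmetricType R}
    (mX : probability (borelT X) R) (mY : probability (borelT Y) R) : \bar R :=
  ereal_inf [set hausdorff (kyfan (@lebesgue_measure R) `[0%R, 1%R[)
                 [set f \o phi | f in @Lip1 R X] [set g \o psi | g in @Lip1 R Y]
            | phi in [set phi | parameter mX phi] & psi in [set psi | parameter mY psi]].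

(* Main.v *)
(** Couplings of [mX] and [mY] induced by parameters have the same concentration
    distance as the parameters, so it is enough to find one pair of parameters
    [phi], [psi] whose distance is at most [dconc_pi] of every coupling.

    Fix a minimizing sequence of couplings [P n] and an ultrafilter [F] on the
    integers. Membership in a countable base of balls codes a point of [X] or [Y]
    by a sequence of bits; completeness makes the decoding a total Borel map. The
    [F]-limits of the [P n]-masses of the cylinder sets are the lengths of a
    consistent nested subdivision of [0,1), so reading off the subinterval
    containing [t] is a random bit sequence with the limiting finite-dimensional
    distributions: no compactness theorem for measures is needed. Decoding its
    even and odd bits gives [phi] and [psi], whose laws are [mX] and [mY] because
    these fix the distribution of the codes.

    For a 1-Lipschitz [f] on [X], near-optimal partners [g n] under [P n] are
    pointwise bounded, so they have a pointwise [F]-limit [h]; convergence is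
    uniform off a set of small mass. The set where [|f - h| > eta] is open, i.e.
    a countable union of rectangles of coding balls, so its mass under
    [(phi, psi)] is at most the limit of its masses under [P n]. *)
Require Import Defs.
From HB Require Import structures.
From mathcomp Require Import all_boot all_order all_algebra.
From mathcomp Require Import all_classical all_reals all_analysis.
From mathcomp Require Import measurable_realfun lra.
Set Implicit Arguments.
Unset Strict Implicit.
Unset Printing Implicit Defensive.
Import Order.TTheory GRing.Theory Num.Theory.
Import numFieldNormedType.Exports.
Local Open Scope classical_set_scope.
Local Open Scope ring_scope.
Local Open Scope ereal_scope.

(** * Bit sequences, words and sets depending on finitely many bits *)

(* The last bit read is the head of the word. *)
Fixpoint word (s : nat -> bool) (n : nat) : seq bool :=
  if n is k.+1 then s k :: word s k else [::].

Lemma word_inj s s' n : word s n = word s' n ->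
  forall i, (i < n)%N -> s i = s' i.
Proof.
elim: n => // n IH [sn /IH{}IH] i; rewrite ltnS leq_eqVlt => /orP[/eqP->//|].
exact: IH.
Qed.

(** Sets depending on finitely many bits. They form the intersection-stable generator of the
    sigma-algebra on [bits], and their masses are the data that pass to the limit. *)
Definition cylindric : set (set (nat -> bool)) :=
  [set Q | exists N, forall s s', word s N = word s' N -> Q s -> Q s'].

Notation bits := (g_sigma_algebraType cylindric).

Lemma cylindricT : cylindric setT.
Proof. by exists 0%N. Qed.

Lemma word_le s s' m n : (m <= n)%N -> word s n = word s' n ->
  word s m = word s' m.
Proof.
move=> mn /word_inj ss'; elim: m mn => //= m IH mn.
by rewrite ss'// IH// ltnW.
Qed.

Lemma cylindricI : setI_closed cylindric.
Proof.
move=> A B [m Am] [n Bn]; exists (maxn m n) => s s' ss' [As Bs]; split.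
  by apply: Am As; apply: word_le ss'; rewrite leq_maxl.
by apply: Bn Bs; apply: word_le ss'; rewrite leq_maxr.
Qed.

Lemma cylindric_bit i : cylindric [set s | s i].
Proof. by exists i.+1 => s s' /word_inj/(_ i (ltnSn i)) /= ->. Qed.

Lemma measurable_bit i : measurable ([set s | s i] : set bits).
Proof. by apply: sub_sigma_algebra; exact: cylindric_bit. Qed.

Definition cylinder (w : seq bool) : set (nat -> bool) :=
  [set s | word s (size w) = w].

Lemma cylindric_cylinder w : cylindric (cylinder w).
Proof. by exists (size w) => s s' ss'; rewrite /cylinder/= ss'. Qed.

Lemma cylinder0 : cylinder [::] = setT.
Proof. by rewrite -subTset. Qed.

Lemma cylinder_cons b w : cylinder (b :: w) = cylinder w `&`
  (if b then [set s | s (size w)] else ~` [set s | s (size w)]).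
Proof.
apply/seteqP; split=> s; rewrite /cylinder/=.
  case=> swb wsb; split=> //; case: b swb => // sw0; apply/negP; exact/negbT.
by case=> ->; case: b => /= [->|/negP/negbTE ->].
Qed.

Lemma cylinderU w : cylinder w = cylinder (true :: w) `|` cylinder (false :: w).
Proof. by rewrite !cylinder_cons -setIUr setUCr setIT. Qed.

Lemma cylinderI w : cylinder (true :: w) `&` cylinder (false :: w) = set0.
Proof. by rewrite !cylinder_cons setIACA setICr setI0. Qed.

(** Splitting on one more bit at a time leads, after [N] bits, to cylinders that lie inside [Q] or
    miss it. The induction runs on [N - size w]. *)
Lemma cylindric_ind (P : set (nat -> bool) -> Prop) :
  P set0 -> (forall w, P (cylinder w)) ->
  (forall A B, cylindric A -> cylindric B -> A `&` B = set0 ->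
    P A -> P B -> P (A `|` B)) ->
  forall Q, cylindric Q -> P Q.
Proof.
move=> P0 Pw PU Q cQ; have [N QN] := cQ.
suff H k w : (N - size w <= k)%N -> P (cylinder w `&` Q).
  by have := H N [::] (leq_subr _ _); rewrite cylinder0 setTI.
elim: k w => [w|k IH w wk].
  rewrite leqn0 subn_eq0 => Nw.
  have [[s [ws Qs]]|] := pselect (cylinder w `&` Q !=set0).
    rewrite (_ : _ `&` _ = cylinder w)//.
    apply/setIidPl => s' ws'; apply: QN Qs; apply: word_le Nw _.
    by rewrite ws ws'.
  by move/set0P/negP/negPn/eqP => ->.
rewrite cylinderU setIUl; apply: PU.
- by apply: cylindricI => //; exact: cylindric_cylinder.
- by apply: cylindricI => //; exact: cylindric_cylinder.
- by rewrite setIACA cylinderI set0I.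
- by apply: IH; rewrite /= subnS -subn1 leq_subLR add1n.
- by apply: IH; rewrite /= subnS -subn1 leq_subLR add1n.
Qed.

(** * Random bit sequences and their laws *)

Lemma measurable_bits d (T : measurableType d) (a : T -> bits) :
  (forall i, measurable [set t | a t i]) -> measurable_fun setT a.
Proof.
move=> ma; apply: (@measurability _ _ T bits setT a cylindric) => // _ [Q cQ <-].
rewrite setTI.
elim/cylindric_ind: Q / cQ => [|w|A B _ _ _ mA mB].
- by rewrite preimage_set0.
- elim: w => [|b w IH]; first by rewrite cylinder0 preimage_setT.
  rewrite cylinder_cons preimage_setI; apply: measurableI => //.
  by case: b; [exact: ma|apply/measurableC/ma].
- by rewrite preimage_setU; exact: measurableU.
Qed.

Lemma measurable_preimage_cylindric d (T : measurableType d) (a : T -> bits)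
  (Q : set bits) : measurable_fun setT a -> cylindric Q -> measurable (a @^-1` Q).
Proof.
move=> ma cQ; rewrite -[X in measurable X]setTI.
by apply: ma => //; exact: sub_sigma_algebra.
Qed.

Lemma fine_measureU d (T : measurableType d) (R : realType)
    (P : probability T R) A B : measurable A -> measurable B ->
  A `&` B = set0 -> fine (P (A `|` B)) = (fine (P A) + fine (P B))%R.
Proof.
move=> mA mB AB0; rewrite measureU// fineD//; exact: fin_num_measure.
Qed.

(** Both sides are additive on disjoint unions, so convergence on cylinders spreads by
    [cylindric_ind]. *)
Lemma cylindric_cvg (R : realType) d1 d2 (T1 : measurableType d1)
    (T2 : measurableType d2) (I : Type) (F : set_system I) (FF : Filter F)
    (a : T1 -> bits) (b : T2 -> bits) (P_ : I -> probability T1 R)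
    (P : probability T2 R) :
  measurable_fun setT a -> measurable_fun setT b ->
  (forall w, (fun n => fine (P_ n (a @^-1` cylinder w))) @ F -->
    fine (P (b @^-1` cylinder w))) ->
  forall Q, cylindric Q ->
    (fun n => fine (P_ n (a @^-1` Q))) @ F --> fine (P (b @^-1` Q)).
Proof.
move=> ma mb Pw; apply: cylindric_ind => // [|A B cA cB AB0 PA PB].
  rewrite preimage_set0 measure0; under eq_fun do rewrite measure0.
  exact: cvg_cst.
have E d (T : measurableType d) (c : T -> bits) (p : probability T R) :
    measurable_fun setT c -> fine (p (c @^-1` (A `|` B))) =
    (fine (p (c @^-1` A)) + fine (p (c @^-1` B)))%R.
  move=> mc; rewrite preimage_setU fine_measureU//.
  - exact: measurable_preimage_cylindric.
  - exact: measurable_preimage_cylindric.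
  - by rewrite -preimage_setI AB0 preimage_set0.
by rewrite E//; under eq_fun do rewrite E//; exact: cvgD.
Qed.

Lemma pushforward_probability d d' (T : measurableType d) (T' : measurableType d')
    (R : realType) (P : probability T R) (f : T -> T') : measurable_fun setT f ->
  exists Q : probability T' R, forall A, Q A = P (f @^-1` A).
Proof.
by move=> mf; exists (distribution P (mfun_Sub (mem_set mf))).
Qed.

(** [cylindric] is closed under intersection and contains the full space, so two probabilities
    agreeing on it coincide; the exhausting sequence is constantly [setT]. *)
Lemma bits_measure_unique (R : realType) d1 d2 (T1 : measurableType d1)
    (T2 : measurableType d2) (a : T1 -> bits) (b : T2 -> bits)
    (P1 : probability T1 R) (P2 : probability T2 R) :
  measurable_fun setT a -> measurable_fun setT b ->
  (forall Q, cylindric Q -> P1 (a @^-1` Q) = P2 (b @^-1` Q)) ->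
  forall A, measurable A -> P1 (a @^-1` A) = P2 (b @^-1` A).
Proof.
move=> /pushforward_probability-/(_ _ P1)[Q1 Q1E].
move=> /pushforward_probability-/(_ _ P2)[Q2 Q2E] eqP A mA.
have cov : \bigcup_(k : nat) [set: bits] = setT.
  by rewrite -subTset => x _; exists 0%N.
have eqQ Q : cylindric Q -> Q1 Q = Q2 Q by move=> /eqP; rewrite -Q1E -Q2E.
rewrite -Q1E -Q2E; have /(_ _ A mA) := @measure_unique _ R bits cylindric
  (fun=> setT) erefl cylindricI (fun=> cylindricT) cov Q1 Q2 eqQ.
by apply=> // _; exact: le_lt_trans (probability_le1 _ _) (ltry _).
Qed.

(** * Lebesgue measure on [0,1) as a probability *)

Section unit_probability.
Context (R : realType).

(** Carried by all of [R], so that random variables on [0,1) can be total functions on the line. *)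
Definition unit_prob : set (measurableTypeR R) -> \bar R :=
  mrestr (@lebesgue_measure R) (measurable_itv `[0%R, 1%R[).

HB.instance Definition _ := Measure.on unit_prob.

Let unit_prob_setT : unit_prob setT = 1.
Proof.
by rewrite /unit_prob /mrestr setTI lebesgue_measure_itv/= lte_fin ltr01 oppr0 adde0.
Qed.

HB.instance Definition _ :=
  Measure_isProbability.Build _ _ R unit_prob unit_prob_setT.

Lemma unit_probE A : unit_prob A = lebesgue_measure (`[0%R, 1%R[ `&` A).
Proof. by rewrite /unit_prob /mrestr setIC. Qed.

End unit_probability.
Arguments unit_prob {R}.

(** * Nested subdivision of [0,1) with prescribed lengths *)

Section nested_intervals.
Context (R : realType) (p : seq bool -> R).
Hypotheses (p_ge0 : forall w, (0 <= p w)%R) (p_nil : p [::] = 1%R).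
Hypothesis p_split : forall w, p w = (p (false :: w) + p (true :: w))%R.

(** The word [w] owns the half-open interval of length [p w] starting at [left_end w]; its [false]
    child takes the left piece and its [true] child the right one. *)
Fixpoint left_end (w : seq bool) : R :=
  if w is b :: v then (left_end v + (if b then p (false :: v) else 0))%R else 0%R.

Fixpoint interval_word (n : nat) (t : R) : seq bool :=
  if n is k.+1 then
    let v := interval_word k t in ((left_end v + p (false :: v))%R <= t)%R :: v
  else [::].

Definition interval_bits (t : measurableTypeR R) : bits := fun n =>
  ((left_end (interval_word n t) + p (false :: interval_word n t))%R <= t)%R.

Lemma word_interval_bits n t : word (interval_bits t) n = interval_word n t.
Proof. by elim: n => //= n ->. Qed.

Lemma interval_wordP w t : (0 <= t < 1)%R ->
  (interval_word (size w) t == w) = (left_end w <= t < left_end w + p w)%R.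
Proof.
move=> t01; elim: w => [|b w IH] /=; first by rewrite p_nil add0r t01.
have := p_split w; have := p_ge0 (false :: w); have := p_ge0 (true :: w).
move=> pt0 pf0 pw; rewrite eqseq_cons.
case: (eqVneq (interval_word (size w) t) w) IH => [->|_] /esym IH /=.
  case/andP: IH => lt tr; rewrite andbT.
  case: b => /=; last by rewrite eqbF_neg -ltNge addr0 lt.
  by rewrite eqb_id; case: (_ <= t)%R => //=; apply/esym; lra.
(* The interval of a child lies inside that of its parent [w], which does not contain [t]. *)
rewrite andbF; apply/esym/negP => /andP[lt tr]; move/negP: IH; apply; apply/andP.
by case: b lt tr => lt tr; lra.
Qed.

Lemma interval_bits_cylinder w : `[0%R, 1%R[ `&` interval_bits @^-1` cylinder w =
  `[left_end w, (left_end w + p w)%R[%classic.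
Proof.
apply/seteqP; split=> t; rewrite /cylinder /= word_interval_bits !in_itv/=.
  by case=> t01 /eqP; rewrite interval_wordP.
move=> tw; have t01 : (0 <= t < 1)%R.
  elim: w tw => [|b w IH] /=; first by rewrite p_nil add0r.
  have := p_split w; have := p_ge0 (false :: w); have := p_ge0 (true :: w).
  by case: b => *; apply: IH; lra.
by split=> //; apply/eqP; rewrite interval_wordP.
Qed.

(** The next bit compares [t] with a threshold fixed by the word already read, and there are only
    countably many words. *)
Lemma measurable_interval_bits : measurable_fun setT interval_bits.
Proof.
have mle w : measurable
    [set t : measurableTypeR R | left_end w + p (false :: w) <= t]%R.
  rewrite [X in measurable X](_ : _ =
    `[(left_end w + p (false :: w))%R, +oo[%classic).
    exact: measurable_itv.
  by apply/seteqP; split=> t; rewrite /= in_itv/= andbT.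
have mword n w : measurable [set t : measurableTypeR R | interval_word n t = w].
  elim: n w => [|n IH] [|b w] /=.
  - by rewrite (_ : mkset _ = setT)// -subTset.
  - by rewrite (_ : mkset _ = set0)// -subset0.
  - by rewrite (_ : mkset _ = set0)// -subset0.
  - rewrite [X in measurable X](_ : _ = [set t | interval_word n t = w] `&`
      (if b then [set t | left_end w + p (false :: w) <= t]%R
       else ~` [set t | left_end w + p (false :: w) <= t]%R)); last first.
      apply/seteqP; split=> t /=.
        by case=> + wt; rewrite wt; case: b => [|/negbT/negP].
      by case=> ->; case: b => /= [->|/negP/negbTE ->].
    apply: measurableI => //; case: b => //; exact: measurableC.
apply: measurable_bits => n.
rewrite [X in measurable X](_ : _ = \bigcup_w ([set t | interval_word n t = w] `&`
   [set t | left_end w + p (false :: w) <= t]%R)); last first.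
  apply/seteqP; split=> [t nt|t [w _ [/= tw]]]; last by rewrite /interval_bits tw.
  by exists (interval_word n t).
apply: countable_bigcupT_measurable => [|w]; first exact: countableP.
exact: measurableI.
Qed.

Lemma unit_prob_interval_bits w :
  unit_prob (interval_bits @^-1` cylinder w) = (p w)%:E.
Proof.
rewrite unit_probE interval_bits_cylinder lebesgue_measure_itv/= lte_fin.
rewrite ltrDl; case: ltP => pw; first by rewrite -EFinB addrAC subrr add0r.
by congr EFin; apply/eqP; rewrite eq_le p_ge0.
Qed.

End nested_intervals.

(** * Ultrafilter limits of distributions of bits *)

Section ultrafilter_limits.
Context (R : realType) (I : Type) (F : set_system I) (FU : UltraFilter F).

Lemma ultra_bounded_cvg (u : I -> R) (M : R) :
  (\forall n \near F, (`|u n| <= M)%R) -> exists l : R, u @ F --> l.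
Proof.
move=> uM; have uF : (u @ F) `[(- M)%R, M]%classic.
  by apply: filterS uM => n; rewrite /= in_itv/= -ler_norml.
have [l [_ ul]] := @segment_compact R (- M)%R M (u @ F) _ uF.
(* The ultrafilter contains a set or its complement, and the complement of a neighbourhood of a
   cluster point is excluded: the cluster point is a limit. *)
exists l => A lA; have [//|FA] := in_ultra_setVsetC (u @^-1` A) FU.
by have [x [? ?]] := ul (~` A) A FA lA.
Qed.

(** The limits of the cylinder masses are nonnegative, have total mass one and are additive under
    splitting, hence are lengths of a nested subdivision. *)
Lemma ultra_limit_bits d (T : measurableType d) (a : T -> bits)
    (P_ : I -> probability T R) : measurable_fun setT a ->
  exists2 Phi : measurableTypeR R -> bits, measurable_fun setT Phi &
    forall Q, cylindric Q -> (fun n => fine (P_ n (a @^-1` Q))) @ F -->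
      fine (unit_prob (Phi @^-1` Q)).
Proof.
move=> ma.
have mw w : measurable (a @^-1` cylinder w).
  by apply: measurable_preimage_cylindric => //; exact: cylindric_cylinder.
have cvgp w : exists l : R, (fun n => fine (P_ n (a @^-1` cylinder w))) @ F --> l.
  apply: (@ultra_bounded_cvg _ 1%R); near=> n.
  rewrite ger0_norm ?fine_ge0// -lee_fin fineK ?fin_num_measure//.
  exact: probability_le1.
have [p pP] := choice cvgp.
have p0 w : (0 <= p w)%R.
  by apply: cvgr_to_ge (pP w) _; near=> n; rewrite fine_ge0.
have pnil : p [::] = 1%R.
  rewrite -(cvg_lim (@norm_hausdorff _ _) (pP [::])); apply: cvg_lim => //.
  rewrite cylinder0 preimage_setT; under eq_fun do rewrite probability_setT.
  exact: cvg_cst.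
have psplit w : p w = (p (false :: w) + p (true :: w))%R.
  rewrite -(cvg_lim (@norm_hausdorff _ _) (pP w)); apply: cvg_lim => //.
  rewrite addrC [X in fmap X](_ : _ = (fun n =>
    fine (P_ n (a @^-1` cylinder (true :: w))) +
    fine (P_ n (a @^-1` cylinder (false :: w))))%R); last first.
    apply/funext => n; rewrite [in LHS]cylinderU preimage_setU fine_measureU//.
    by rewrite -preimage_setI cylinderI preimage_set0.
  exact: cvgD.
exists (interval_bits p); first exact: measurable_interval_bits.
apply: cylindric_cvg => //; first exact: measurable_interval_bits.
by move=> w; have := pP w; rewrite -[p w]/(fine (p w)%:E) -unit_prob_interval_bits.
Unshelve. all: end_near. Qed.

End ultrafilter_limits.

(** * Coding points by a countable base of balls *)

Lemma open_mdist_ball (R : realType) (X : metricType R) (y : X) (e : R) :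
  open [set x | (mdist x y < e)%R].
Proof.
rewrite openE => x /= xe; apply/nbhs_ballP; exists (e - mdist x y)%R => /=.
  by rewrite subr_gt0.
move=> z; rewrite ballEmdist/= ltrBrDl addrC; apply: le_lt_trans.
by rewrite (metric_sym x z) metric_triangle.
Qed.

Lemma separable_ball_base (R : realType) (X : pmetricType R) :
  separable_space X -> exists (c : nat -> X) (r : nat -> R),
    forall x (e : R), (0 < e)%R -> exists2 j, (r j < e)%R & (mdist x (c j) < r j)%R.
Proof.
move=> [D [/countable_injP[f injf] denseD]].
(* A left inverse of the injection [f] on [D], equal to [point] off the range of [f]. *)
pose c n := xget point [set y | D y /\ f y = n].
have cf y : D y -> c (f y) = y.
  move=> Dy; rewrite /c; case: xgetP => [z _ [Dz fz]|/(_ y)/=]; last by case.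
  by apply: injf; rewrite ?inE.
(* Indices that encode no pair get radius 0, an empty open ball, so their bit is never set in the
   code of a point. *)
pose cr j : X * R :=
  if unpickle j is Some (k, n) then (c n, k.+1%:R^-1%R) else (point, 0%R).
exists (fst \o cr), (snd \o cr) => x e e0.
have [k _ ke] := near_infty_natSinv_lt (PosNum e0).
have {}ke : (k.+1%:R^-1 < e)%R by apply: ke => /=.
have k0 : (0 < k.+1%:R^-1 :> R)%R by rewrite invr_gt0.
have [y [xy Dy]] : [set y : X | (mdist y x < k.+1%:R^-1)%R] `&` D !=set0.
  by apply: denseD; [exists x; rewrite /= mdistxx|exact: open_mdist_ball].
by exists (pickle (k, f y)); rewrite /= /cr pickleK//= cf// metric_sym.
Qed.

Section ball_code.
Context (R : realType) (X : pmetricType R) (c : nat -> X) (r : nat -> R).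
Hypothesis base : forall x (e : R), (0 < e)%R ->
  exists2 j, (r j < e)%R & (mdist x (c j) < r j)%R.

Definition ball_code (x : borelT X) : bits := fun j => (mdist (x : X) (c j) < r j)%R.

(** Countably many conditions on bits, so a measurable set; they make the centres of shrinking coded
    balls a Cauchy sequence. *)
Definition consistent : set bits := [set s |
  (forall k, exists j, s j /\ (r j < k.+1%:R^-1)%R) /\
  (forall i j, s i -> s j -> (mdist (c i) (c j) <= r i + r j)%R)].

(* The point of the singleton intersection of the closed balls coded by [s]. *)
Definition ball_decode (s : bits) : borelT X :=
  xget point [set x : X | consistent s /\ forall j, s j -> (mdist x (c j) <= r j)%R].

Lemma ball_code_consistent x : consistent (ball_code x).
Proof.
split=> [k|i j si sj].
  have [|j rj xj] := @base x (k.+1%:R^-1)%R; first by rewrite invr_gt0.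
  by exists j.
apply: le_trans (metric_triangle _ (x : X) _) _.
by rewrite metric_sym; apply: lerD; apply: ltW.
Qed.

(** Coded balls of radius below [1/(k+1)] have Cauchy centres by consistency. Their limit lies in
    every coded closed ball, so the set from which [ball_decode] chooses is nonempty. *)
Lemma ball_decodeP s : complete_space X -> consistent s ->
  forall j, s j -> (mdist (ball_decode s : X) (c j) <= r j)%R.
Proof.
move=> cX cs; rewrite /ball_decode; case: xgetP => [x _ [] //|noX].
exfalso; have [/choice[j jP] sr] := cs.
have inv_near (e : R) : (0 < e)%R ->
    exists N, forall n, (N <= n)%N -> (n.+1%:R^-1 < e)%R.
  move=> e0; have [N _ NP] := near_infty_natSinv_lt (PosNum e0).
  by exists N => n Nn; exact: NP.
have [l ul] : exists l : X, (c \o j) @ \oo --> l.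
  apply: cX => e e0; have [|N NP] := inv_near (e / 2)%R; first by rewrite divr_gt0.
  exists N => m n Nm Nn; have [sm rm] := jP m; have [sn rn] := jP n.
  apply: le_lt_trans (sr _ _ sm sn) _.
  by rewrite (splitr e) ltrD// (lt_trans rm, lt_trans rn)// NP.
apply: (noX l); split=> // i si; apply/ler_addgt0Pl => e e0.
have e2 : (0 < e / 2)%R by rewrite divr_gt0.
have [N1 _ N1P] := cvg_ball ul e2.
have [N2 N2P] := inv_near (e / 2)%R e2.
pose n := maxn N1 N2.
have /N1P /= : (N1 <= n)%N by rewrite leq_maxl.
rewrite ballEmdist/= => ln; have ne := N2P n (leq_maxr _ _).
have [sn rn] := jP n; have rni := sr _ _ sn si.
have rne := lt_trans rn ne.
by have := metric_triangle l (c (j n)) (c i); move: ln rne rni; lra.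
Qed.

Lemma consistent_decode_eq s x : complete_space X -> consistent s ->
  (forall j, s j -> (mdist x (c j) <= r j)%R) -> ball_decode s = x.
Proof.
move=> cX cs xs; apply: mdist_positivity; apply/eqP.
rewrite eq_le mdist_ge0 andbT; apply/ler_addgt0Pl => e e0; rewrite addr0.
have e2 : (0 < e / 2)%R by rewrite divr_gt0.
have [N _ /(_ _ (leqnn N)) NP] := near_infty_natSinv_lt (PosNum e2).
have [/(_ N)[j [sj rj]] _] := cs.
apply: le_trans (metric_triangle _ (c j) _) _.
have := ball_decodeP cX cs sj; have := xs _ sj; rewrite (metric_sym (c j)).
by have := lt_trans rj NP; rewrite /=; lra.
Qed.

Lemma ball_codeK : complete_space X -> cancel ball_code ball_decode.
Proof.
move=> cX x; apply: consistent_decode_eq => //; first exact: ball_code_consistent.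
by move=> j /ltW.
Qed.

(** A sufficiently small coded ball fits inside [U], so a single bit certifies that the decoded
    point is in [U]. *)
Lemma ball_decode_open (U : set X) s : complete_space X -> consistent s ->
  open U -> U (ball_decode s) ->
  exists2 j, s j & forall y, (mdist y (c j) <= r j)%R -> U y.
Proof.
move=> cX cs oU Us.
have /nbhs_ballP[e /= e0 eU] : nbhs (ball_decode s : X) U by exact: open_nbhs_nbhs.
have e2 : (0 < e / 2)%R by rewrite divr_gt0.
have [N _ /(_ _ (leqnn N)) NP] := near_infty_natSinv_lt (PosNum e2).
have [/(_ N)[j [sj rj]] _] := cs; exists j => // y yj; apply: eU.
rewrite ballEmdist/=; apply: le_lt_trans (metric_triangle _ (c j) _) _.
have := ball_decodeP cX cs sj; move: yj; rewrite (metric_sym (c j)).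
by have := lt_trans rj NP; rewrite /=; lra.
Qed.

Lemma measurable_consistent : measurable consistent.
Proof.
rewrite (_ : consistent =
  (\bigcap_k \bigcup_(j in [set j | r j < k.+1%:R^-1]%R) [set s : bits | s j]) `&`
  \bigcap_i \bigcap_(j in [set j | ~ (mdist (c i) (c j) <= r i + r j)%R])
    ~` ([set s : bits | s i] `&` [set s : bits | s j])).
  apply: measurableI.
    apply: bigcapT_measurable => k; apply: bigcup_measurable => j _.
    exact: measurable_bit.
  apply: bigcapT_measurable => i; apply: bigcap_measurableType => j _.
  by apply: measurableC; apply: measurableI; exact: measurable_bit.
apply/seteqP; split=> s [s1 s2]; split.
- by move=> k _; have [j [sj rj]] := s1 k; exists j.
- by move=> i _ j /= + [si sj]; apply; exact: s2.
- by move=> k; have [j /= rj sj] := s1 k Logic.I; exists j.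
- by move=> i j si sj; apply: contrapT => ij; exact: (s2 i Logic.I j ij).
Qed.

(** On consistent sequences the preimage of an open set is a countable union of one-bit events;
    elsewhere the decoded value is the constant [point]. *)
Lemma measurable_ball_decode : complete_space X -> measurable_fun setT ball_decode.
Proof.
move=> cX; apply: (@measurability _ _ bits (borelT X) setT ball_decode open) => //.
move=> _ [U oU <-]; rewrite setTI.
rewrite (_ : _ @^-1` _ = (consistent `&` \bigcup_(j in
    [set j | forall y, (mdist y (c j) <= r j)%R -> U y]) [set s : bits | s j]) `|`
    (~` consistent `&` [set s | U point])); last first.
  apply/seteqP; split=> s /=.
    move=> Us; have [cs|ncs] := pselect (consistent s); [left|right]; split=> //.
      by have [j sj jU] := ball_decode_open cX cs oU Us; exists j.
    by move: Us; rewrite /ball_decode xgetPN// => x [].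
  case=> -[cs]; last by rewrite /= /ball_decode xgetPN// => x [].
  by move=> [j /= jU sj]; apply: jU; exact: ball_decodeP.
apply: measurableU; apply: measurableI.
- exact: measurable_consistent.
- by apply: bigcup_measurable => j _; exact: measurable_bit.
- by apply: measurableC; exact: measurable_consistent.
- have [Up|nUp] := pselect (U point).
    by rewrite (_ : mkset _ = setT)//; apply/seteqP; split.
  by rewrite (_ : mkset _ = set0)//; apply/seteqP; split.
Qed.

Lemma measurable_ball_code : measurable_fun setT ball_code.
Proof.
apply: measurable_bits => j; apply: sub_sigma_algebra.
exact: open_mdist_ball.
Qed.

End ball_code.

(** * Mass estimates and the Ky Fan metric *)

Lemma measure_bigcup_le d (T : measurableType d) (R : realType)
    (P : {measure set T -> \bar R}) (A : nat -> set T) (M : \bar R) :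
  (forall k, measurable (A k)) ->
  (forall m, P (\big[setU/set0]_(k < m) A k) <= M) -> P (\bigcup_k A k) <= M.
Proof.
move=> mA AM; rewrite -bigcup_bigsetU_bigcup.
have mB m : measurable (\big[setU/set0]_(k < m.+1) A k) by exact: bigsetU_measurable.
have ndB : nondecreasing_seq (fun m => \big[setU/set0]_(k < m.+1) A k).
  by move=> m n mn; exact/subsetPset/subset_bigsetU.
have /(_ R P) := nondecreasing_cvg_mu mB (bigcup_measurable (fun k _ => mB k)) ndB.
move=> /cvg_lim <-//; apply: lime_le; last by near=> m; exact: AM.
apply: ereal_nondecreasing_is_cvgn => m n mn; apply: le_measure; rewrite ?inE//.
exact/subsetPset/ndB.
Unshelve. all: end_near. Qed.

Lemma hausdorff_image (R : realType) (T S S' : Type) (dist : T -> T -> \bar R)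
    (A : set S) (B : set S') (F : S -> T) (G : S' -> T) :
  hausdorff dist [set F f | f in A] [set G g | g in B] =
  maxe (ereal_sup [set ereal_inf [set dist (F f) (G g) | g in B] | f in A])
       (ereal_sup [set ereal_inf [set dist (F f) (G g) | f in A] | g in B]).
Proof.
rewrite /hausdorff !image_comp; congr (maxe (ereal_sup _) (ereal_sup _));
  by apply: eq_imagel => x _ /=; rewrite image_comp.
Qed.

Section kyfan_probability.
Context d (Z : measurableType d) (R : realType) (P : probability Z R).
Implicit Types f g : Z -> R.

Lemma measurable_dist_gt f g (e : R) : measurable_fun setT f -> measurable_fun setT g ->
  measurable [set z | (e < `|f z - g z|)%R].
Proof.
move=> mf mg; rewrite -[X in measurable X]setTI.
rewrite (_ : mkset _ = (fun z => `|f z - g z|)%R @^-1` `]e, +oo[%classic); last first.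
  by apply/seteqP; split=> z; rewrite /= in_itv/= andbT.
apply: (measurableT_comp (@normr_measurable R setT) (measurable_funB mf mg)) => //.
Qed.

Lemma kyfan_le f g (e : R) : (0 <= e)%R -> P [set z | (e < `|f z - g z|)%R] <= e%:E ->
  kyfan P setT f g <= e%:E.
Proof.
by move=> e0 Pe; apply: ereal_inf_lbound; exists e => //; split=> //; rewrite setTI.
Qed.

Lemma kyfan_le1 f g : measurable_fun setT f -> measurable_fun setT g ->
  kyfan P setT f g <= 1.
Proof.
by move=> mf mg; apply: kyfan_le => //; apply: probability_le1; exact: measurable_dist_gt.
Qed.

Lemma kyfan_lt f g (e : R) : measurable_fun setT f -> measurable_fun setT g ->
  kyfan P setT f g < e%:E -> P [set z | (e < `|f z - g z|)%R] <= e%:E.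
Proof.
move=> mf mg /ereal_inf_lt[_ [r [r0 Pr] <-]]; rewrite lte_fin => re.
apply: le_trans (le_trans Pr _); last by rewrite lee_fin ltW.
rewrite setTI; apply: le_measure; rewrite ?inE; try exact: measurable_dist_gt.
by move=> z /=; exact: lt_trans.
Qed.

End kyfan_probability.

Lemma measurable_Lip1 (R : realType) (X : pmetricType R) (f : borelT X -> R) :
  @Lip1 R X f -> measurable_fun setT f.
Proof.
move=> lf; apply: (measurability _ (RGenOInfty.measurableE R)) => //.
move=> _ [_ [a ->] <-]; rewrite setTI; apply: sub_sigma_algebra.
rewrite openE => x /=; rewrite in_itv/= andbT => ax.
apply/nbhs_ballP; exists (f x - a)%R => /=; first by rewrite subr_gt0.
move=> y; rewrite ballEmdist/= in_itv/= andbT => xy.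
by have := lf x y; move/ler_normlW; lra.
Qed.

(** If every finite union missed mass more than [e], continuity from below would bound the total
    mass by [1 - e]. *)
Lemma probability_cover d (T : measurableType d) (R : realType)
    (P : probability T R) (A : nat -> set T) (e : R) :
  (forall k, measurable (A k)) -> \bigcup_k A k = setT -> (0 < e)%R ->
  exists N, P (~` \big[setU/set0]_(k < N) A k) <= e%:E.
Proof.
move=> mA AT e0; have mB m : measurable (\big[setU/set0]_(k < m) A k).
  exact: bigsetU_measurable.
apply: contrapT => /forallNP noN.
suff : P setT <= (1 - e)%:E.
  by rewrite probability_setT lee_fin; lra.
rewrite -AT; apply: measure_bigcup_le => // m.
have /negP := noN m; rewrite -ltNge probability_setC//.
have Bfin := fineK (fin_num_measure P _ (mB m)).
rewrite -Bfin -EFinB lte_fin => eB; rewrite -[leLHS]Bfin lee_fin; lra.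
Qed.

Lemma probability_lt1_nonempty d (T : measurableType d) (R : realType)
    (P : probability T R) (A : set T) : P A < 1 -> exists x, ~ A x.
Proof.
move=> PA; apply: contrapT => /forallNP noA; move: PA.
rewrite (_ : A = setT) ?probability_setT ?ltxx//.
by rewrite -subTset => x _; exact: contrapT (noA x).
Qed.

Lemma Lip1_dist (R : realType) (W : pmetricType R) (g : W -> R) x y : @Lip1 R W g ->
  (`|g x| <= `|g y| + mdist x y)%R.
Proof.
move=> lg; have := lg x y; have := ler_normD (g x - g y)%R (g y).
by rewrite subrK; lra.
Qed.

Lemma measurable_mdist_ball (R : realType) (W : pmetricType R) (y : W) (e : R) :
  measurable ([set x | (mdist x y < e)%R] : set (borelT W)).
Proof. by apply: sub_sigma_algebra; exact: open_mdist_ball. Qed.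

(** Tightness in the form used below: with growing radii it confines a point to a bounded set, with
    small balls around a dense family to finitely many of them, up to mass [eta]. *)
Lemma probability_cover_lt d (T : measurableType d) (R : realType)
    (P : probability T R) (h : nat -> T -> R) (e : nat -> R) (eta : R) :
  (forall k, measurable [set x | (h k x < e k)%R]) ->
  (forall x, exists k, (h k x < e k)%R) -> (0 < eta)%R ->
  exists N (B : set T), [/\ measurable B, P B <= eta%:E &
    forall x, ~ B x -> exists2 k, (k < N)%N & (h k x < e k)%R].
Proof.
move=> mh cov eta0.
have [|N PN] := @probability_cover _ _ _ P
  (fun k => [set x | (h k x < e k)%R]) eta mh _ eta0.
  by rewrite -subTset => x _; have [k hk] := cov x; exists k.
exists N; eexists; split; [|exact: PN|].
  by apply: measurableC; exact: bigsetU_measurable.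
by move=> x /contrapT; rewrite -(bigcup_mkord N (fun k => [set x | (h k x < e k)%R])).
Qed.

(** * Ultrafilter limits of Lipschitz functions *)

Section lipschitz_limit.
Context (R : realType) (X Y : pmetricType R).
Context (mX : probability (borelT X) R) (mY : probability (borelT Y) R).
Context d (Z : measurableType d) (u : Z -> borelT X) (v : Z -> borelT Y).
Hypotheses (mu : measurable_fun setT u) (mv : measurable_fun setT v).
Context (F : set_system nat) (FU : UltraFilter F) (P : nat -> probability Z R).
Hypothesis Pu : forall n A, measurable A -> P n (u @^-1` A) = mX A.
Hypothesis Pv : forall n A, measurable A -> P n (v @^-1` A) = mY A.

(** Since [e < 1], the bad set and two sets of small mass cannot fill [Z]. At a remaining [z], the
    value [f (u z)] is bounded, [g n (v z)] is close to it, and the Lipschitz bound leads to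
    [y0]. *)
Lemma bounded_Lip1_near f (g : nat -> Y -> R) (e : R) (y0 : Y) :
  @Lip1 R X f -> (forall n, @Lip1 R Y (g n)) -> (e < 1)%R ->
  (\forall n \near F, P n [set z | (e < `|f (u z) - g n (v z)|)%R] <= e%:E) ->
  exists K : R, \forall n \near F, (`|g n y0| <= K)%R.
Proof.
(* Chosen so that [2 * eta + e < 1]. *)
move=> lf lg e1 Pe; pose eta := ((1 - e) / 4)%R.
have eta0 : (0 < eta)%R by rewrite /eta; lra.
have cov (W : pmetricType R) (y x : W) : exists k : nat, (mdist x y < k%:R)%R.
  by exists (Num.truncn (mdist x y)).+1; exact: truncnS_gt.
have [M [A [mA PA MA]]] := probability_cover_lt mX
  (fun k => measurable_mdist_ball point k%:R) (cov X point) eta0.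
have [N [B [mB PB NB]]] := probability_cover_lt mY
  (fun k => measurable_mdist_ball y0 k%:R) (cov Y y0) eta0.
exists (`|f point| + M%:R + 1 + N%:R)%R.
apply: filterS Pe => n Pe.
have mfg : measurable [set z | (e < `|f (u z) - g n (v z)|)%R].
  by apply: measurable_dist_gt; apply: measurableT_comp => //; exact: measurable_Lip1.
have muA : measurable (u @^-1` A) by rewrite -[X in measurable X]setTI; exact: mu.
have mvB : measurable (v @^-1` B) by rewrite -[X in measurable X]setTI; exact: mv.
have PnA : P n (u @^-1` A) <= eta%:E by rewrite Pu.
have PnB : P n (v @^-1` B) <= eta%:E by rewrite Pv.
have [|z /not_orP[/not_orP[/MA[k kM uk] /NB[l lN vl]] /negP]] :=
  @probability_lt1_nonempty _ _ _ (P n) (u @^-1` A `|` v @^-1` B `|`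
    [set z | (e < `|f (u z) - g n (v z)|)%R]).
  apply: le_lt_trans (measureU2 _ _ _) _ => //; first exact: measurableU.
  apply: (@le_lt_trans _ _ ((eta + eta)%:E + e%:E)).
    apply: leeD => //; apply: le_trans (measureU2 _ _ _) _ => //.
    by rewrite EFinD; exact: leeD.
  by rewrite -EFinD lte_fin /eta; lra.
rewrite -leNgt => fgz.
have kM' : (k%:R <= M%:R :> R)%R by rewrite ler_nat ltnW.
have lN' : (l%:R <= N%:R :> R)%R by rewrite ler_nat ltnW.
have := Lip1_dist y0 (v z) (lg n); have := Lip1_dist (u z : X) point lf.
have := ler_normB (f (u z)) (f (u z) - g n (v z))%R; rewrite opprB addrC subrK.
rewrite (metric_sym y0); lra.
Qed.

Lemma Lip1_ultra_limit f (g : nat -> Y -> R) (e : R) : separable_space Y ->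
  @Lip1 R X f -> (forall n, @Lip1 R Y (g n)) -> (e < 1)%R ->
  (\forall n \near F, P n [set z | (e < `|f (u z) - g n (v z)|)%R] <= e%:E) ->
  exists2 h, @Lip1 R Y h & forall eta : R, (e < eta)%R ->
    \forall n \near F, P n [set z | (eta < `|f (u z) - h (v z)|)%R] <= eta%:E.
Proof.
move=> sY lf lg e1 Pe.
have cvgg y : exists l : R, (fun n => g n y) @ F --> l.
  have [K gK] := bounded_Lip1_near y lf lg e1 Pe.
  exact: ultra_bounded_cvg gK.
have [h gh] := choice cvgg.
have lh : @Lip1 R Y h.
  move=> x y; apply: cvgr_to_le (cvg_norm (cvgB (gh x) (gh y))) _.
  by near=> n; exact: lg.
(* Off [B], the detour through a centre [c k] costs three errors of at most [del], so [|f - h|] is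
   at most [e + 3 * del < eta]; the exceptional mass is at most [e + del <= eta]. *)
exists h => // eta eeta; pose del := ((eta - e) / 4)%R.
have del0 : (0 < del)%R by rewrite /del; lra.
have [c [r base]] := separable_ball_base sY.
have [N [B [mB PB NB]]] := probability_cover_lt mY (e := fun=> del)
  (fun k => measurable_mdist_ball (c k) del)
  (fun y => let: ex_intro2 k rk yk := base y _ del0 in
     ex_intro _ k (lt_trans yk rk)) del0.
(* Only finitely many centres are involved, so pointwise convergence is uniform on them. *)
have near_c : \forall n \near F, forall k, (k < N)%N ->
    (`|g n (c k) - h (c k)| < del)%R.
  elim: (N) => [|m IH]; first by near=> n.
  have hm : \forall n \near F, (`|g n (c m) - h (c m)| < del)%R.
    by have /cvgrPdist_lt/(_ _ del0) := gh (c m); apply: filterS => n; rewrite distrC.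
  apply: filterS2 IH hm => n nm nc k; rewrite ltnS leq_eqVlt => /orP[/eqP->//|].
  exact: nm.
apply: filterS2 near_c Pe => n nc Pe.
have mfg : measurable [set z | (e < `|f (u z) - g n (v z)|)%R].
  by apply: measurable_dist_gt; apply: measurableT_comp => //; exact: measurable_Lip1.
have mfh : measurable [set z | (eta < `|f (u z) - h (v z)|)%R].
  by apply: measurable_dist_gt; apply: measurableT_comp => //; exact: measurable_Lip1.
have mvB : measurable (v @^-1` B) by rewrite -[X in measurable X]setTI; exact: mv.
apply: (@le_trans _ _ (P n ([set z | (e < `|f (u z) - g n (v z)|)%R] `|` v @^-1` B))).
  apply: le_measure; rewrite ?inE//; first exact: measurableU.
  move=> z /= etaz; have [|/NB[k kN vk]] := pselect (B (v z)); [by right|left].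
  have := nc k kN; have := lg n (v z) (c k); have := lh (v z) (c k).
  have eq : (f (u z) - h (v z) = (f (u z) - g n (v z)) + (g n (v z) - g n (c k))
     + (g n (c k) - h (c k)) - (h (v z) - h (c k)))%R by lra.
  move: etaz; rewrite eq /del in vk *.
  have := ler_normB ((f (u z) - g n (v z)) + (g n (v z) - g n (c k))
     + (g n (c k) - h (c k)))%R (h (v z) - h (c k))%R.
  have := ler_normD ((f (u z) - g n (v z)) + (g n (v z) - g n (c k)))%R
     (g n (c k) - h (c k))%R.
  have := ler_normD (f (u z) - g n (v z))%R (g n (v z) - g n (c k))%R.
  rewrite /=; move: vk; lra.
have PnB : P n (v @^-1` B) <= del%:E by rewrite Pv.
apply: le_trans (measureU2 _ _ _) _ => //.
apply: le_trans (leeD Pe PnB) _; rewrite -EFinD lee_fin /del; lra.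
Unshelve. all: end_near. Qed.

End lipschitz_limit.

(** * Interleaved codes and the laws of decoded points *)

Lemma word_ext s s' n : (forall i, (i < n)%N -> s i = s' i) -> word s n = word s' n.
Proof.
by elim: n => //= n IH ss'; rewrite ss'// IH// => i /ltnW; exact: ss'.
Qed.

Lemma cylindric_reindex (h : nat -> nat) (Q : set bits) : cylindric Q ->
  cylindric [set s : nat -> bool | Q (s \o h)].
Proof.
move=> [N QN]; exists (\max_(i < N) (h i).+1) => s s' /word_inj ss'.
apply: QN; apply: word_ext => i iN /=; apply: ss'.
exact: (leq_bigmax (Ordinal iN)).
Qed.

Lemma measurable_reindex (h : nat -> nat) :
  measurable_fun setT ((fun s => s \o h) : bits -> bits).
Proof. by apply: measurable_bits => i; exact: measurable_bit. Qed.

Lemma cylindricU A B : cylindric A -> cylindric B -> cylindric (A `|` B).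
Proof.
move=> [m Am] [n Bn]; exists (maxn m n) => s s' ss' [As|Bs]; [left|right].
  by apply: Am As; apply: word_le ss'; rewrite leq_maxl.
by apply: Bn Bs; apply: word_le ss'; rewrite leq_maxr.
Qed.

Lemma cylindric0 : cylindric set0.
Proof. by exists 0%N. Qed.

Definition interleave (s s' : nat -> bool) : bits :=
  fun n => if odd n then s' n./2 else s n./2.

Lemma interleave_even s s' : interleave s s' \o double = s.
Proof. by apply/funext => n; rewrite /interleave/= odd_double doubleK. Qed.

Lemma interleave_odd s s' : interleave s s' \o (succn \o double) = s'.
Proof. by apply/funext => n; rewrite /interleave/= odd_double/= uphalf_double. Qed.

Section decoded_marginal.
Context (R : realType) (X : pmetricType R) (c : nat -> X) (r : nat -> R).
Hypothesis base : forall x (e : R), (0 < e)%R ->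
  exists2 j, (r j < e)%R & (mdist x (c j) < r j)%R.
Hypothesis cX : complete_space X.
Context (mX : probability (borelT X) R) d (T : measurableType d)
  (P : probability T R) (Phi : T -> bits).
Hypothesis mPhi : measurable_fun setT Phi.
Hypothesis PhiX : forall Q, cylindric Q -> P (Phi @^-1` Q) = mX (ball_code c r @^-1` Q).

(** The bits have the law of the code of an [mX]-random point, and decoding inverts coding. *)
Lemma decode_distribution A : measurable A ->
  P ((ball_decode c r \o Phi) @^-1` A) = mX A.
Proof.
move=> mA; have mdA : measurable (ball_decode c r @^-1` A).
  by rewrite -[X in measurable X]setTI; exact: measurable_ball_decode.
rewrite comp_preimage (bits_measure_unique mPhi (measurable_ball_code c r) PhiX mdA).
by congr (mX _); apply/seteqP; split=> x /=; rewrite ball_codeK.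
Qed.

(** Codes of actual points are consistent. Consistency depends on infinitely many bits, so equality
    of the full laws is used. *)
Lemma consistent_ae : P (Phi @^-1` (~` consistent c r)) = 0.
Proof.
rewrite (bits_measure_unique mPhi (measurable_ball_code c r) PhiX).
  rewrite (_ : _ @^-1` _ = set0) ?measure0// -subset0 => x /=; apply.
  exact: ball_code_consistent.
by apply: measurableC; exact: measurable_consistent.
Qed.

End decoded_marginal.

(** * A limiting pair of parameters *)

Section joint_parameter.
Context (R : realType) (X Y : pmetricType R).
Hypotheses (hXc : complete_space X) (hXs : separable_space X)
  (hYc : complete_space Y) (hYs : separable_space Y).
Context (mX : probability (borelT X) R) (mY : probability (borelT Y) R).
Context (F : set_system nat) (FU : UltraFilter F)
  (P : nat -> probability (borelT X * borelT Y)%type R).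
Hypothesis cP : forall n, coupling mX mY (P n).

(** Both maps decode the same limiting bit sequence. The last clause is the portmanteau inequality
    for open sets along [F], with openness of [V] expressed through open rectangles. *)
Lemma joint_parameter : exists (phi : measurableTypeR R -> borelT X)
    (psi : measurableTypeR R -> borelT Y),
  [/\ measurable_fun setT phi /\ measurable_fun setT psi,
    (forall A, measurable A -> unit_prob (phi @^-1` A) = mX A),
    (forall B, measurable B -> unit_prob (psi @^-1` B) = mY B) &
    forall (V : set (borelT X * borelT Y)) (M : R), measurable V ->
      (forall x y, V (x, y) -> exists (A : set X) (B : set Y),
         [/\ open A, open B, A x, B y & A `*` B `<=` V]) ->
      (\forall n \near F, P n V <= M%:E) ->
      unit_prob [set t | V (phi t, psi t)] <= M%:E].
Proof.
have [c [r base]] := separable_ball_base hXs.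
have [c' [r' base']] := separable_ball_base hYs.
pose a (z : borelT X * borelT Y) : bits :=
  interleave (ball_code c r z.1) (ball_code c' r' z.2).
have mcX := measurable_ball_code c r; have mcY := measurable_ball_code c' r'.
have ma : measurable_fun setT a.
  apply: measurable_bits => i; rewrite /a /interleave; case: (odd i).
    have := measurableT_comp mcY (@measurable_snd _ _ (borelT X) (borelT Y)).
    move=> /(_ measurableT _ (measurable_bit i./2)); by rewrite setTI.
  have := measurableT_comp mcX (@measurable_fst _ _ (borelT X) (borelT Y)).
  move=> /(_ measurableT _ (measurable_bit i./2)); by rewrite setTI.
have [Phi mPhi PhiP] := ultra_limit_bits FU P ma.
pose PhiX : measurableTypeR R -> bits := fun t => Phi t \o double.
pose PhiY : measurableTypeR R -> bits := fun t => Phi t \o (succn \o double).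
have mPhiX : measurable_fun setT PhiX.
  exact: measurableT_comp (measurable_reindex double) mPhi.
have mPhiY : measurable_fun setT PhiY.
  exact: measurableT_comp (measurable_reindex (succn \o double)) mPhi.
(* Masses independent of [n] survive the limit; this fixes both marginals. *)
have const_lim Q m : m \is a fin_num -> cylindric Q ->
    (forall n, P n (a @^-1` Q) = m) -> unit_prob (Phi @^-1` Q) = m.
  move=> fm cQ PQ; have mQ := measurable_preimage_cylindric mPhi cQ.
  have := PhiP _ cQ; rewrite (_ : (fun n => fine _) = fun=> fine m); last first.
    by apply/funext => n; rewrite PQ.
  move=> /cvg_lim-/(_ (@norm_hausdorff _ _)); rewrite lim_cst// => mE.
  by rewrite -[LHS](fineK (fin_num_measure _ _ mQ)) -mE fineK.
have PhiXP Q : cylindric Q -> unit_prob (PhiX @^-1` Q) = mX (ball_code c r @^-1` Q).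
  move=> cQ; have mQ := measurable_preimage_cylindric mcX cQ.
  apply: const_lim (cylindric_reindex double cQ) _; first exact: fin_num_measure.
  move=> n; have [<-// _] := cP n; congr (P n _); apply/seteqP; split=> z.
    by rewrite /= /a interleave_even.
  by case; rewrite /= /a interleave_even.
have PhiYP Q : cylindric Q -> unit_prob (PhiY @^-1` Q) = mY (ball_code c' r' @^-1` Q).
  move=> cQ; have mQ := measurable_preimage_cylindric mcY cQ.
  apply: const_lim (cylindric_reindex (succn \o double) cQ) _; first exact: fin_num_measure.
  move=> n; have [_ <-//] := cP n; congr (P n _); apply/seteqP; split=> z.
    by rewrite /= /a interleave_odd.
  by case; rewrite /= /a interleave_odd.
exists (ball_decode c r \o PhiX), (ball_decode c' r' \o PhiY).
have mdX := measurable_ball_decode c r hXc.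
have mdY := measurable_ball_decode c' r' hYc.
split; first by split; exact: measurableT_comp.
- exact: decode_distribution.
- exact: decode_distribution.
move=> V M mV oV PVM.
(* Pairs of closed balls with product inside [V]; the events [E k] below say that both bits of such
   a pair are set. *)
pose W := [set ij : nat * nat | forall x y, (mdist x (c ij.1) <= r ij.1)%R ->
  (mdist y (c' ij.2) <= r' ij.2)%R -> V (x, y)].
pose E k : set (nat -> bool) := if unpickle k is Some ij then
  [set s | [/\ W ij, s ij.1.*2 & s ij.2.*2.+1]] else set0.
have cE k : cylindric (E k).
  rewrite /E; case: unpickle => [[i j]|]; last exact: cylindric0.
  have [Wij|nW] := pselect (W (i, j)).
    rewrite (_ : mkset _ = [set s | s i.*2] `&` [set s | s j.*2.+1]).
      by apply: cylindricI; exact: cylindric_bit.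
    by apply/seteqP; split=> s; [case|case; split].
  by rewrite (_ : mkset _ = set0) -?subset0 => [|s []//]; exact: cylindric0.
have cEU m : cylindric (\big[setU/set0]_(k < m) E k).
  by elim/big_ind: _ => //; [exact: cylindric0|exact: cylindricU].
have EV k : a @^-1` E k `<=` V.
  rewrite /E; case: unpickle => [[i j]|//] [x y] /= [Wij ai aj].
  apply: Wij; apply: ltW => /=.
    by move: ai; rewrite -[_ i.*2]/((_ \o double) i) interleave_even.
  by move: aj; rewrite -[_ j.*2.+1]/((_ \o (succn \o double)) j) interleave_odd.
(* Inconsistent sequences decode to a default value, so they are set aside; they have mass zero by
   [consistent_ae]. *)
have VE : [set t |
    V ((ball_decode c r \o PhiX) t, (ball_decode c' r' \o PhiY) t)] `<=`
    \bigcup_k Phi @^-1` E k `|` (PhiX @^-1` (~` consistent c r) `|`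
      PhiY @^-1` (~` consistent c' r')).
  move=> t /= Vt; have [kX|] := pselect (consistent c r (PhiX t)); last by right; left.
  have [kY|] := pselect (consistent c' r' (PhiY t)); last by right; right.
  left; have [A [B [oA oB At Bt AB]]] := oV _ _ Vt.
  have [i ti iA] := ball_decode_open hXc kX oA At.
  have [j tj jB] := ball_decode_open hYc kY oB Bt.
  exists (pickle (i, j)) => //=; rewrite /E pickleK; split=> // x y xi yj.
  by apply: AB; split; [exact: iA|exact: jB].
have mE k : measurable (Phi @^-1` E k) by exact: measurable_preimage_cylindric.
have mNX : measurable (PhiX @^-1` (~` consistent c r)).
  rewrite -[X in measurable X]setTI; apply: mPhiX => //; apply: measurableC.
  exact: measurable_consistent.
have mNY : measurable (PhiY @^-1` (~` consistent c' r')).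
  rewrite -[X in measurable X]setTI; apply: mPhiY => //; apply: measurableC.
  exact: measurable_consistent.
have mUE : measurable (\bigcup_k Phi @^-1` E k) by exact: bigcupT_measurable.
have mN := measurableU _ _ mNX mNY.
have mV' : measurable [set t |
    V ((ball_decode c r \o PhiX) t, (ball_decode c' r' \o PhiY) t)].
  rewrite -[X in measurable X]setTI; apply: measurable_fun_pair => //.
    exact: measurableT_comp.
  exact: measurableT_comp.
(* Finite unions of the [E k] are cylindric, so their masses are limits of masses of subsets of [V];
   continuity from below does the rest. *)
have UE : unit_prob (\bigcup_k Phi @^-1` E k) <= M%:E.
  apply: measure_bigcup_le => // m.
  rewrite (_ : \big[_/_]_(k < m) _ =
    Phi @^-1` (\big[setU/set0]_(k < m) E k)); last first.
    by elim/big_ind2: _ => // A A' B B' -> ->.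
  have mUEm := measurable_preimage_cylindric mPhi (cEU m).
  rewrite -[leLHS](fineK (fin_num_measure _ _ mUEm)) lee_fin.
  apply: cvgr_to_le (PhiP _ (cEU m)) _; apply: filterS PVM => n PVM.
  have maE := measurable_preimage_cylindric ma (cEU m).
  rewrite -lee_fin fineK ?fin_num_measure//; apply: le_trans PVM.
  apply: le_measure; rewrite ?inE//.
  by rewrite -bigcup_mkord => z [k _]; exact: EV.
have NX0 : unit_prob (PhiX @^-1` (~` consistent c r)) <= 0.
  by have := consistent_ae base mPhiX PhiXP => ->.
have NY0 : unit_prob (PhiY @^-1` (~` consistent c' r')) <= 0.
  by have := consistent_ae base' mPhiY PhiYP => ->.
have N0 : unit_prob (PhiX @^-1` (~` consistent c r) `|`
    PhiY @^-1` (~` consistent c' r')) <= 0.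
  by apply: le_trans (measureU2 _ _ _) _ => //; rewrite -[leRHS]adde0; exact: leeD.
apply: le_trans (le_measure _ _ _ VE) _; rewrite ?inE//; first exact: measurableU.
apply: le_trans (measureU2 _ _ _) _ => //.
by rewrite -[leRHS]adde0; exact: leeD.
Qed.

End joint_parameter.

(** * Lower semicontinuity of the Hausdorff distance *)

Lemma kyfan_unit (R : realType) (F G : R -> R) :
  kyfan (@lebesgue_measure R) `[0%R, 1%R[ F G =
  @kyfan R _ (measurableTypeR R) unit_prob setT F G.
Proof.
rewrite /kyfan; congr (ereal_inf [set _ | _ in _]).
by apply/seteqP; split=> e /= [e0]; rewrite setTI unit_probE.
Qed.

Lemma Lip1_cst (R : realType) (X : pmetricType R) (k : R) : @Lip1 R X (cst k).
Proof. by move=> x y; rewrite subrr normr0 mdist_ge0. Qed.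

Lemma open_Lip1_dist_gt (R : realType) (X Y : pmetricType R) f g (e : R) x y :
  @Lip1 R X f -> @Lip1 R Y g -> (e < `|f x - g y|)%R ->
  exists (A : set X) (B : set Y), [/\ open A, open B, A x, B y &
    A `*` B `<=` [set z | (e < `|f z.1 - g z.2|)%R]].
Proof.
move=> lf lg exy; pose del := ((`|f x - g y| - e) / 2)%R.
have del0 : (0 < del)%R by rewrite /del; lra.
exists [set x' | (mdist x' x < del)%R], [set y' | (mdist y' y < del)%R].
split; [exact: open_mdist_ball|exact: open_mdist_ball| | |].
- by rewrite /= mdistxx.
- by rewrite /= mdistxx.
move=> [x' y'] /= [xx yy].
have := lf x' x; have := lg y' y.
have := ler_normD (f x - f x')%R (f x' - g y')%R.
have := ler_normD (f x - f x' + (f x' - g y'))%R (g y' - g y)%R.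
rewrite (_ : (f x - f x' + (f x' - g y') + (g y' - g y) = f x - g y)%R); last by lra.
rewrite (distrC (f x') (f x)); move: xx yy; rewrite /del; lra.
Qed.

Section lower_semicontinuity.
Context (R : realType) (X Y : pmetricType R).
Context (mX : probability (borelT X) R) (mY : probability (borelT Y) R).
Context d (Z : measurableType d) (u : Z -> borelT X) (v : Z -> borelT Y).
Hypotheses (mu : measurable_fun setT u) (mv : measurable_fun setT v).
Context (F : set_system nat) (FU : UltraFilter F) (P : nat -> probability Z R).
Hypothesis Pu : forall n A, measurable A -> P n (u @^-1` A) = mX A.
Hypothesis Pv : forall n A, measurable A -> P n (v @^-1` A) = mY A.
Context d' (T : measurableType d') (Q : probability T R).
Context (phi : T -> borelT X) (psi : T -> borelT Y).
Hypothesis mphi : measurable_fun setT phi.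
Hypothesis PQ : forall f h (e : R), @Lip1 R X f -> @Lip1 R Y h ->
  (\forall n \near F, P n [set z | (e < `|f (u z) - h (v z)|)%R] <= e%:E) ->
  Q [set t | (e < `|f (phi t) - h (psi t)|)%R] <= e%:E.

(** Near-optimal partners of [f] under [P n] have an ultralimit [h], and [PQ] carries the bound on
    [|f - h|] over to [Q]. Abstract [u] and [v] let one statement serve both halves of the Hausdorff
    distance. *)
Lemma inf_kyfan_le f (e eta : R) : separable_space Y -> @Lip1 R X f ->
  (e < eta)%R ->
  (\forall n \near F,
    ereal_inf [set kyfan (P n) setT (f \o u) (g \o v) | g in @Lip1 R Y] < e%:E) ->
  ereal_inf [set kyfan Q setT (f \o phi) (h \o psi) | h in @Lip1 R Y] <= eta%:E.
Proof.
move=> sY lf eeta Pe.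
have infle h : @Lip1 R Y h -> kyfan Q setT (f \o phi) (h \o psi) <= eta%:E ->
    ereal_inf [set kyfan Q setT (f \o phi) (h \o psi) | h in @Lip1 R Y] <= eta%:E.
  by move=> lh; apply: le_trans; apply: ereal_inf_lbound; exists h.
have mfphi : measurable_fun setT (f \o phi).
  by apply: measurableT_comp => //; exact: measurable_Lip1.
(* Ky Fan distances never exceed 1, so any partner works here; the other case supplies the bound
   [e < 1]. *)
have [eta1|eta1] := leP 1%R eta.
  apply: (infle (cst 0%R)); first exact: Lip1_cst.
  apply: (@le_trans _ _ 1); last by rewrite lee_fin.
  by apply: kyfan_le1 => //; exact: measurable_cst.
have /choice[g gP] n : exists g, @Lip1 R Y g /\
    (ereal_inf [set kyfan (P n) setT (f \o u) (g \o v) | g in @Lip1 R Y] < e%:E ->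
     P n [set z | (e < `|f (u z) - g (v z)|)%R] <= e%:E).
  have [|] := boolP
    (ereal_inf [set kyfan (P n) setT (f \o u) (g \o v) | g in @Lip1 R Y] < e%:E).
    move=> /ereal_inf_lt[_ [g lg <-]] ge; exists g; split=> // _.
    by apply: kyfan_lt ge; apply: measurableT_comp => //; exact: measurable_Lip1.
  by exists (cst 0%R); split => //; exact: Lip1_cst.
have [|h lh hP] := Lip1_ultra_limit mu mv FU Pu Pv sY lf (fun n => (gP n).1)
  (lt_trans eeta eta1).
  by apply: filterS Pe => n; exact: (gP n).2.
have Qeta := PQ lf lh (hP _ eeta).
apply: (infle h lh); apply: kyfan_le => //.
(* [0 <= eta] because a nonnegative mass is at most [eta]. *)
by rewrite -lee_fin; apply: le_trans Qeta.
Qed.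

End lower_semicontinuity.

(** * From parameters to couplings *)

Lemma parameter_coupling (R : realType) (X Y : pmetricType R)
    (mX : probability (borelT X) R) (mY : probability (borelT Y) R)
    (phi : R -> borelT X) (psi : R -> borelT Y) :
  parameter mX phi -> parameter mY psi ->
  exists2 pi : probability (borelT X * borelT Y)%type R, coupling mX mY pi &
    dconc_pi pi = hausdorff (kyfan (@lebesgue_measure R) `[0%R, 1%R[)
      [set f \o phi | f in @Lip1 R X] [set g \o psi | g in @Lip1 R Y].
Proof.
move=> [mphi phiX] [mpsi psiY].
(* Parameters are measurable on [0,1) only; a constant value outside makes them total measurable
   maps without affecting masses under [unit_prob]. *)
have mphi' : measurable_fun setT (phi \_ `[0%R, 1%R[).
  by apply/(measurable_restrictT _ (measurable_itv _)).
have mpsi' : measurable_fun setT (psi \_ `[0%R, 1%R[).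
  by apply/(measurable_restrictT _ (measurable_itv _)).
have [pi piE] := pushforward_probability (@unit_prob R)
  (measurable_fun_pair mphi' mpsi' : @measurable_fun _ _ (measurableTypeR R) _ _ _).
have {}piE A : pi A = lebesgue_measure (`[0%R, 1%R[ `&` [set t | A (phi t, psi t)]).
  rewrite piE -[LHS]/(unit_prob _) unit_probE; congr (lebesgue_measure _).
  by apply/seteqP; split=> t /= [t01]; rewrite !patchE !mem_set.
exists pi.
  split=> A mA; rewrite piE; [rewrite -phiX//|rewrite -psiY//];
    congr (lebesgue_measure _); apply/seteqP; split=> t /=.
  - by case=> ? [].
  - by case.
  - by case=> ? [].
  - by case.
have kE f g : kyfan pi setT (f \o fst) (g \o snd) =
   kyfan (@lebesgue_measure R) `[0%R, 1%R[ (f \o phi) (g \o psi).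
  rewrite /kyfan; congr (ereal_inf [set _ | _ in _]).
  by apply/seteqP; split=> e /= [e0]; rewrite setTI piE.
rewrite /dconc_pi !hausdorff_image; congr (maxe (ereal_sup _) (ereal_sup _)).
  by apply: eq_imagel => f _; congr ereal_inf; apply: eq_imagel => g _; exact: kE.
by apply: eq_imagel => f _; congr ereal_inf; apply: eq_imagel => g _; exact: kE.
Qed.

(** * Attainment of the minimum *)

Lemma kyfanC (R : realType) d (Z : measurableType d) (mu : set Z -> \bar R) D f g :
  kyfan mu D f g = kyfan mu D g f.
Proof.
by rewrite /kyfan; under [in LHS]eq_set do under eq_set do rewrite distrC.
Qed.

Lemma lt_real_between (R : realType) (x : \bar R) (r : R) : x < r%:E ->
  exists2 e : R, x < e%:E & (e < r)%R.
Proof.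
case: x => [x| |]//; rewrite ?lte_fin => xr.
  by exists ((x + r) / 2)%R; rewrite ?lte_fin; lra.
by exists (r - 1)%R; rewrite ?ltNyr//; lra.
Qed.

Lemma lee_real_above (R : realType) (x y : \bar R) :
  (forall r : R, y < r%:E -> x <= r%:E) -> x <= y.
Proof.
case: y => [y| |] xy; last 2 first.
- by rewrite leey.
- by rewrite (eq_ninfty (fun r => xy r (ltNyr r))).
apply/lee_addgt0Pr => e e0; rewrite -EFinD; apply: xy.
by rewrite lte_fin ltrDl.
Qed.

Theorem theorem5p2 (R : realType) (X Y : pmetricType R)
  (hXc : complete_space X) (hXs : separable_space X)
  (hYc : complete_space Y) (hYs : separable_space Y)
  (mX : probability (borelT X) R) (mY : probability (borelT Y) R) :
  exists pi : probability (borelT X * borelT Y)%type R,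
    coupling mX mY pi /\
    dconc mX mY = dconc_pi pi /\
    (forall pi' : probability (borelT X * borelT Y)%type R,
        coupling mX mY pi' -> dconc_pi pi <= dconc_pi pi').
Proof.
pose C := [set dconc_pi pi | pi in [set pi | coupling mX mY pi]].
have C0 : C !=set0.
  have mXT : mX setT = 1 by exact: probability_setT.
  have mYT : mY setT = 1 by exact: probability_setT.
  (* The product measure is a coupling, so a minimizing sequence exists. *)
  exists (dconc_pi (mX \x mY)); exists (mX \x mY) => //; split=> A mA.
    by rewrite /= product_measure1E// [X in _ * X]mYT mule1.
  by rewrite /= product_measure1E// [X in X * _]mXT mul1e.
have [w Cw wC] := ereal_inf_seq ((set0P _).2 C0).
have /choice[P PC] n : exists p : probability (borelT X * borelT Y)%type R,
    coupling mX mY p /\ dconc_pi p = w n.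
  by have [p cp <-] := Cw n; exists p.
(* Finer than the eventual filter, so [w] still tends to the infimum along [F]. *)
have [F [FU ooF]] := ultraFilterLemma (eventually_filter : ProperFilter \oo).
have cP n : coupling mX mY (P n) := (PC n).1.
have [phi [psi [[mphi mpsi] phiX psiY phipsi]]] :=
  joint_parameter hXc hXs hYc hYs FU cP.
have pphi : parameter mX phi.
  split; last by move=> A mA; rewrite -phiX// unit_probE.
  exact: measurable_funS mphi.
have ppsi : parameter mY psi.
  split; last by move=> A mA; rewrite -psiY// unit_probE.
  exact: measurable_funS mpsi.
have [pi cpi piE] := parameter_coupling pphi ppsi.
have Pfst n A : measurable A -> P n (fst @^-1` A) = mX A.
  move=> mA; rewrite -(cP n).1//; congr (P n _).
  by apply/seteqP; split=> z //= [].
have Psnd n A : measurable A -> P n (snd @^-1` A) = mY A.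
  move=> mA; rewrite -(cP n).2//; congr (P n _).
  by apply/seteqP; split=> z //= [].
have transfer f g (e : R) : @Lip1 R X f -> @Lip1 R Y g ->
    (\forall n \near F, P n [set z | (e < `|f z.1 - g z.2|)%R] <= e%:E) ->
    unit_prob [set t | (e < `|f (phi t) - g (psi t)|)%R] <= e%:E.
  move=> lf lg; apply: (phipsi [set z | (e < `|f z.1 - g z.2|)%R]).
    apply: measurable_dist_gt.
      exact: measurableT_comp (measurable_Lip1 lf) measurable_fst.
    exact: measurableT_comp (measurable_Lip1 lg) measurable_snd.
  by move=> x y; exact: open_Lip1_dist_gt.
have pi_le : dconc_pi pi <= ereal_inf C.
  (* A level [e] strictly between the infimum and [eta] provides the gap that [inf_kyfan_le]
     consumes. *)
  apply: lee_real_above => eta /lt_real_between[e Ce eeta].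
  have we : \forall n \near F, dconc_pi (P n) < e%:E.
    apply: ooF.
    have : \forall n \near \oo, w n < e%:E by exact: wC (open_ereal_lt' Ce).
    by apply: filterS => n; rewrite (PC n).2.
  have kE f g : kyfan (@lebesgue_measure R) `[0%R, 1%R[ (f \o phi) (g \o psi) =
      kyfan unit_prob setT (f \o phi) (g \o psi) by exact: kyfan_unit.
  rewrite piE hausdorff_image ge_max.
  apply/andP; split; apply: ge_ereal_sup => _ [f lf <-].
    rewrite (_ : [set _ | _ in _] = [set kyfan unit_prob setT (f \o phi) (g \o psi) |
      g in @Lip1 R Y]); last by apply: eq_imagel => g _; exact: kE.
    apply: (inf_kyfan_le measurable_fst measurable_snd FU Pfst Psnd mphi
      transfer hYs lf eeta).
    apply: filterS we => n; rewrite /dconc_pi hausdorff_image gt_max => /andP[+ _].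
    by apply: le_lt_trans; apply: ereal_sup_ubound; exists f.
  (* The other half of the Hausdorff distance: [X] and [Y] are exchanged, using symmetry of the Ky
     Fan distance. *)
  rewrite (_ : [set _ | _ in _] = [set kyfan unit_prob setT (f \o psi) (g \o phi) |
    g in @Lip1 R X]); last by apply: eq_imagel => g _; rewrite kE kyfanC.
  apply: (inf_kyfan_le measurable_snd measurable_fst FU Psnd Pfst mpsi _ hXs lf eeta).
    move=> g h e' lg lh Pe'; under eq_set do rewrite distrC.
    by apply: transfer => //; apply: filterS Pe' => n; under eq_set do rewrite distrC.
  apply: filterS we => n; rewrite /dconc_pi hausdorff_image gt_max => /andP[_].
  apply: le_lt_trans; apply: le_trans; last first.
    by apply: ereal_sup_ubound; exists f.
  by rewrite le_eqVlt; apply/orP; left; apply/eqP; congr ereal_inf;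
    apply: eq_imagel => g _; rewrite kyfanC.
have pi_min pi' : coupling mX mY pi' -> dconc_pi pi <= dconc_pi pi'.
  by move=> cpi'; apply: le_trans pi_le _; apply: ereal_inf_lbound; exists pi'.
(* [phi] and [psi] compete in [dconc], giving one inequality; conversely every pair of parameters
   induces a coupling, to which minimality applies. *)
exists pi; split=> //; split=> //; apply/eqP; rewrite eq_le; apply/andP; split.
  by rewrite piE; apply: ereal_inf_lbound; exists phi => //; exists psi.
apply: le_ereal_inf_tmp => _ [phi' pphi' [psi' ppsi' <-]].
have [pi' cpi' <-] := parameter_coupling pphi' ppsi'.
exact: pi_min.
Qed.
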